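(* There exists an algorithm that produces, for any term $t$, positive integers $m,n_1,\dots,n_m$ and basic terms $t_{i,j}$ ($i\in\{1,\dots,m\}$, $j\in\{1,\dots,n_i\}$) such that for every fully distributive involutive residuated lattice $\mathbf{L}$, $\mathbf{L}\models t\approx\bigwedge_{i=1}^m\bigvee_{j=1}^{n_i}t_{i,j}$.
   Context: An involutive residuated lattice is an algebra $\langle L,\wedge,\vee,\cdot,{}',1\rangle$ such that $\langle L,\cdot,1\rangle$ is a monoid, $\langle L,\wedge,\vee\rangle$ is a lattice, ${}'$ is an involution of the lattice ($a\le b\iff b'\le a'$, $a''=a$), and for all $a,b,c$: $b\le(c'a)'\iff ab\le c\iff a\le(bc')'$. It is fully distributive if its lattice reduct is distributive and $a(b_1\wedge b_2)c=ab_1c\wedge ab_2c$ for all $a,b_1,b_2,c$. Terms are built from a countably infinite set of variables using $\wedge,\vee,\cdot,{}',1$; a basic term is one built using only $\cdot$, ${}'$ and $1$ (and variables). *)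

(* Defs.v *)
From Stdlib Require Import List.
Import ListNotations.

Inductive term : Type :=
| TVar  : nat -> term
| TMeet : term -> term -> term
| TJoin : term -> term -> term
| TMul  : term -> term -> term
| TInv  : term -> term
| TOne  : term.

Fixpoint is_basic (t : term) : Prop :=
  match t with
  | TVar _ => True
  | TMeet _ _ => False
  | TJoin _ _ => False
  | TMul a b => is_basic a /\ is_basic b
  | TInv a => is_basic a
  | TOne => True
  end.

Record IRL : Type := {
  car :> Type;
  meet : car -> car -> car;
  join : car -> car -> car;
  mul  : car -> car -> car;
  inv  : car -> car;
  one  : car;
  meet_comm : forall a b, meet a b = meet b a;
  join_comm : forall a b, join a b = join b a;
  meet_assoc : forall a b c, meet a (meet b c) = meet (meet a b) c;
  join_assoc : forall a b c, join a (join b c) = join (join a b) c;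
  meet_absorb : forall a b, meet a (join a b) = a;
  join_absorb : forall a b, join a (meet a b) = a;
  mul_assoc : forall a b c, mul a (mul b c) = mul (mul a b) c;
  mul_one_l : forall a, mul one a = a;
  mul_one_r : forall a, mul a one = a;
  inv_antitone : forall a b, meet a b = a <-> meet (inv b) (inv a) = inv b;
  inv_inv : forall a, inv (inv a) = a;
  (* residuation: b <= (c'a)'  <->  ab <= c  <->  a <= (bc')' *)
  resid_l : forall a b c,
    meet b (inv (mul (inv c) a)) = b <-> meet (mul a b) c = mul a b;
  resid_r : forall a b c,
    meet (mul a b) c = mul a b <-> meet a (inv (mul b (inv c))) = a
}.

Definition le (L : IRL) (a b : L) : Prop := meet L a b = a.

Definition fully_distributive (L : IRL) : Prop :=
  (forall a b c : L, meet L a (join L b c) = join L (meet L a b) (meet L a c)) /\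
  (forall a b1 b2 c : L,
     mul L (mul L a (meet L b1 b2)) c =
     meet L (mul L (mul L a b1) c) (mul L (mul L a b2) c)).

Fixpoint eval (L : IRL) (v : nat -> L) (t : term) : L :=
  match t with
  | TVar n => v n
  | TMeet a b => meet L (eval L v a) (eval L v b)
  | TJoin a b => join L (eval L v a) (eval L v b)
  | TMul a b => mul L (eval L v a) (eval L v b)
  | TInv a => inv L (eval L v a)
  | TOne => one L
  end.

Definition models_eq (L : IRL) (s t : term) : Prop :=
  forall v : nat -> L, eval L v s = eval L v t.

(* Iterated join / meet of a list of terms, as terms; intended for
   nonempty lists (the default TOne is never used in that case). *)
Definition big_join (l : list term) : term :=
  match l with
  | [] => TOne
  | x :: xs => fold_left TJoin xs x
  end.

Definition big_meet (l : list term) : term :=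
  match l with
  | [] => TOne
  | x :: xs => fold_left TMeet xs x
  end.

Definition meet_of_joins (tbl : list (list term)) : term :=
  big_meet (map big_join tbl).

(* Main.v *)
Require Import Defs.
From Stdlib Require Import List.
Import ListNotations.

(* Every term is equivalent to a meet of joins of basic terms, and such a
   normal form is computed by structural recursion: a meet of normal forms
   is one by concatenation; a join of two of them is distributed into one by
   lattice distributivity; a product distributes over joins (multiplication
   is residuated) and over meets (full distributivity); and the involution
   turns a meet of joins into a join of meets (De Morgan), which lattice
   distributivity brings back into normal form. *)

Local Infix "⊓" := (meet _) (at level 40, left associativity).
Local Infix "⊔" := (join _) (at level 50, left associativity).
Local Infix "⋅" := (mul _) (at level 39, left associativity).
Local Infix "≤" := (le _) (at level 70, no associativity).

Lemma fold_left_morph {B C} (op : B -> B -> B) (op' : C -> C -> C) (h : B -> C) :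
  (forall x y, h (op x y) = op' (h x) (h y)) ->
  forall l x, h (fold_left op l x) = fold_left op' (map h l) (h x).
Proof.
  intros h_morph l; induction l as [|y l IHl]; intro x; cbn; [reflexivity|].
  now rewrite IHl, h_morph.
Qed.

Lemma fold_left_assoc {B} (op : B -> B -> B) :
  (forall x y z, op (op x y) z = op x (op y z)) ->
  forall l x y, fold_left op l (op x y) = op x (fold_left op l y).
Proof.
  intros op_assoc l; induction l as [|z l IHl]; intros x y; cbn; [reflexivity|].
  now rewrite op_assoc, IHl.
Qed.

(* Nonempty lists, as head and tail: normal forms then have at least one row
   and rows at least one entry by construction. *)
Definition ne (A : Type) : Type := A * list A.

Definition ne_list {A} (a : ne A) : list A := fst a :: snd a.
Definition ne_single {A} (x : A) : ne A := (x, []).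
Definition ne_app {A} (a b : ne A) : ne A := (fst a, snd a ++ ne_list b).
Definition ne_map {A B} (f : A -> B) (a : ne A) : ne B := (f (fst a), map f (snd a)).

Definition ne_foldmap {A B} (op : B -> B -> B) (f : A -> B) (a : ne A) : B :=
  fold_left op (map f (snd a)) (f (fst a)).

Definition ne_bind {A B} (g : A -> ne B) (a : ne A) : ne B := ne_foldmap ne_app g a.

Lemma ne_foldmap_morph {A B C} (op : B -> B -> B) (op' : C -> C -> C) (h : B -> C)
    (f : A -> B) a :
  (forall x y, h (op x y) = op' (h x) (h y)) ->
  h (ne_foldmap op f a) = ne_foldmap op' (fun x => h (f x)) a.
Proof.
  intro h_morph; unfold ne_foldmap.
  now rewrite (fold_left_morph op op' h h_morph), map_map.
Qed.

Lemma ne_foldmap_ext {A B} (op : B -> B -> B) (f g : A -> B) a :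
  (forall x, f x = g x) -> ne_foldmap op f a = ne_foldmap op g a.
Proof. intro fg; unfold ne_foldmap; now rewrite (map_ext f g fg), fg. Qed.

Lemma ne_foldmap_map {A A' B} (op : B -> B -> B) (f : A' -> B) (g : A -> A') a :
  ne_foldmap op f (ne_map g a) = ne_foldmap op (fun x => f (g x)) a.
Proof. unfold ne_foldmap; cbn; now rewrite map_map. Qed.

Section NeFoldmapAssoc.

Variables (B : Type) (op : B -> B -> B).
Hypothesis op_assoc : forall x y z, op (op x y) z = op x (op y z).

Lemma ne_foldmap_app {A} (f : A -> B) a b :
  ne_foldmap op f (ne_app a b) = op (ne_foldmap op f a) (ne_foldmap op f b).
Proof.
  destruct a as [x xs], b as [y ys]; unfold ne_foldmap; cbn.
  rewrite map_app, fold_left_app; cbn.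
  now apply fold_left_assoc.
Qed.

Lemma ne_foldmap_bind {A A'} (f : A' -> B) (g : A -> ne A') a :
  ne_foldmap op f (ne_bind g a) = ne_foldmap op (fun x => ne_foldmap op f (g x)) a.
Proof. apply ne_foldmap_morph; intros; now apply ne_foldmap_app. Qed.

End NeFoldmapAssoc.

Section IRLTheory.

Variable L : IRL.
Implicit Types a b c x y z : L.

Lemma meet_idem a : a ⊓ a = a.
Proof. rewrite <- (meet_absorb L a (a ⊓ a)) at 3; now rewrite join_absorb. Qed.

Lemma meet_assoc_sym x y z : x ⊓ y ⊓ z = x ⊓ (y ⊓ z).
Proof. symmetry; apply meet_assoc. Qed.

Lemma join_assoc_sym x y z : x ⊔ y ⊔ z = x ⊔ (y ⊔ z).
Proof. symmetry; apply join_assoc. Qed.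

Lemma le_refl a : a ≤ a.
Proof. apply meet_idem. Qed.

Lemma le_trans a b c : a ≤ b -> b ≤ c -> a ≤ c.
Proof. unfold le; intros ab bc; now rewrite <- ab, <- meet_assoc, bc. Qed.

Lemma le_antisym a b : a ≤ b -> b ≤ a -> a = b.
Proof.
  unfold le; intros ab ba.
  rewrite <- ab; rewrite <- ba at 2; apply meet_comm.
Qed.

Lemma le_iff_join a b : a ≤ b <-> a ⊔ b = b.
Proof.
  unfold le; split; intro H; rewrite <- H.
  - now rewrite join_comm, meet_comm, join_absorb.
  - apply meet_absorb.
Qed.

Lemma le_joinl a b : a ≤ a ⊔ b.
Proof. apply meet_absorb. Qed.

Lemma le_joinr a b : b ≤ a ⊔ b.
Proof. rewrite join_comm; apply le_joinl. Qed.

Lemma join_lub a b c : a ≤ c -> b ≤ c -> a ⊔ b ≤ c.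
Proof. rewrite !le_iff_join; intros ac bc; now rewrite <- join_assoc, bc, ac. Qed.

Lemma le_meetl a b : a ⊓ b ≤ a.
Proof. unfold le; now rewrite (meet_comm L a b), <- meet_assoc, meet_idem. Qed.

Lemma le_meetr a b : a ⊓ b ≤ b.
Proof. rewrite meet_comm; apply le_meetl. Qed.

Lemma meet_glb a b c : c ≤ a -> c ≤ b -> c ≤ a ⊓ b.
Proof. unfold le; intros ca cb; now rewrite meet_assoc, ca, cb. Qed.

Lemma inv_le a b : a ≤ b -> inv L b ≤ inv L a.
Proof. apply inv_antitone. Qed.

Lemma inv_meet x y : inv L (x ⊓ y) = inv L x ⊔ inv L y.
Proof.
  apply le_antisym.
  - rewrite <- (inv_inv L (inv L x ⊔ inv L y)).
    apply inv_le, meet_glb.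
    + rewrite <- (inv_inv L x) at 2; apply inv_le, le_joinl.
    + rewrite <- (inv_inv L y) at 2; apply inv_le, le_joinr.
  - apply join_lub; apply inv_le; [apply le_meetl | apply le_meetr].
Qed.

Lemma inv_join x y : inv L (x ⊔ y) = inv L x ⊓ inv L y.
Proof.
  rewrite <- (inv_inv L x), <- (inv_inv L y) at 1.
  now rewrite <- inv_meet, inv_inv.
Qed.

Lemma mul_mono_l a b c : b ≤ c -> a ⋅ b ≤ a ⋅ c.
Proof.
  intro bc; apply resid_l; eapply le_trans; [exact bc|].
  apply resid_l, le_refl.
Qed.

Lemma mul_mono_r a b c : b ≤ c -> b ⋅ a ≤ c ⋅ a.
Proof.
  intro bc; apply resid_r; eapply le_trans; [exact bc|].
  apply resid_r, le_refl.
Qed.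

(* Both bounds of the join lie below the residual of [a ⋅ b ⊔ a ⋅ c] by [a]. *)
Lemma mul_join_l a b c : a ⋅ (b ⊔ c) = a ⋅ b ⊔ a ⋅ c.
Proof.
  apply le_antisym.
  - apply resid_l, join_lub; apply resid_l; [apply le_joinl | apply le_joinr].
  - apply join_lub; apply mul_mono_l; [apply le_joinl | apply le_joinr].
Qed.

Lemma mul_join_r a b c : (b ⊔ c) ⋅ a = b ⋅ a ⊔ c ⋅ a.
Proof.
  apply le_antisym.
  - apply resid_r, join_lub; apply resid_r; [apply le_joinl | apply le_joinr].
  - apply join_lub; apply mul_mono_r; [apply le_joinl | apply le_joinr].
Qed.

Section Distributive.

Hypothesis meet_join_distr : forall a b c : L, a ⊓ (b ⊔ c) = a ⊓ b ⊔ a ⊓ c.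

Lemma join_meet_distr_l x y z : x ⊔ y ⊓ z = (x ⊔ y) ⊓ (x ⊔ z).
Proof.
  rewrite meet_join_distr, (meet_comm L (x ⊔ y) x), meet_absorb.
  rewrite (meet_comm L (x ⊔ y) z), meet_join_distr.
  now rewrite join_assoc, (meet_comm L z x), join_absorb, (meet_comm L z y).
Qed.

Lemma join_meet_distr_r x y z : y ⊓ z ⊔ x = (y ⊔ x) ⊓ (z ⊔ x).
Proof. now rewrite join_comm, join_meet_distr_l, (join_comm L x y), (join_comm L x z). Qed.

End Distributive.

Section FullyDistributive.

Hypothesis mul_meet_distr :
  forall a b1 b2 c : L, a ⋅ (b1 ⊓ b2) ⋅ c = a ⋅ b1 ⋅ c ⊓ a ⋅ b2 ⋅ c.

Lemma mul_meet_l a b c : a ⋅ (b ⊓ c) = a ⋅ b ⊓ a ⋅ c.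
Proof. pose proof (mul_meet_distr a b c (one L)) as H; now rewrite !mul_one_r in H. Qed.

Lemma mul_meet_r a b c : (b ⊓ c) ⋅ a = b ⋅ a ⊓ c ⋅ a.
Proof. pose proof (mul_meet_distr (one L) b c a) as H; now rewrite !mul_one_l in H. Qed.

End FullyDistributive.

End IRLTheory.

Definition basic_term : Type := {s : term | is_basic s}.

Definition basic_var n : basic_term := exist _ (TVar n) I.
Definition basic_one : basic_term := exist _ TOne I.
Definition basic_mul (s t : basic_term) : basic_term :=
  exist _ (TMul (proj1_sig s) (proj1_sig t)) (conj (proj2_sig s) (proj2_sig t)).
Definition basic_inv (s : basic_term) : basic_term :=
  exist _ (TInv (proj1_sig s)) (proj2_sig s).

(* A [row] stands for the join of its entries, a [cnf] for the meet of its rows. *)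
Definition row : Type := ne basic_term.
Definition cnf : Type := ne row.

Definition cnf_join (A B : cnf) : cnf := ne_bind (fun a => ne_map (ne_app a) B) A.
Definition row_mul (a b : row) : row := ne_bind (fun s => ne_map (basic_mul s) b) a.
Definition cnf_mul (A B : cnf) : cnf := ne_bind (fun a => ne_map (row_mul a) B) A.
Definition row_inv (a : row) : cnf := ne_map (fun s => ne_single (basic_inv s)) a.

(* De Morgan: the involution of a meet of joins is the join of the meets
   [row_inv a] of the involutions of the entries. *)
Definition cnf_inv (A : cnf) : cnf := ne_foldmap cnf_join row_inv A.

Fixpoint cnf_of (t : term) : cnf :=
  match t with
  | TVar n => ne_single (ne_single (basic_var n))
  | TOne => ne_single (ne_single basic_one)
  | TMeet s t => ne_app (cnf_of s) (cnf_of t)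
  | TJoin s t => cnf_join (cnf_of s) (cnf_of t)
  | TMul s t => cnf_mul (cnf_of s) (cnf_of t)
  | TInv t => cnf_inv (cnf_of t)
  end.

Definition row_terms (a : row) : list term := map (@proj1_sig _ _) (ne_list a).
Definition cnf_table (A : cnf) : list (list term) := map row_terms (ne_list A).

Section CnfSemantics.

Variables (L : IRL) (v : nat -> L).

Definition basic_eval (s : basic_term) : L := eval L v (proj1_sig s).
Definition row_eval (a : row) : L := ne_foldmap (join L) basic_eval a.
Definition cnf_eval (A : cnf) : L := ne_foldmap (meet L) row_eval A.

Lemma row_eval_app a b : row_eval (ne_app a b) = row_eval a ⊔ row_eval b.
Proof. apply ne_foldmap_app, join_assoc_sym. Qed.

Lemma cnf_eval_app A B : cnf_eval (ne_app A B) = cnf_eval A ⊓ cnf_eval B.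
Proof. apply ne_foldmap_app, meet_assoc_sym. Qed.

Lemma row_eval_mul a b : row_eval (row_mul a b) = row_eval a ⋅ row_eval b.
Proof.
  unfold row_mul, row_eval; rewrite ne_foldmap_bind by apply join_assoc_sym.
  rewrite (ne_foldmap_morph (join L) (join L) (fun x => x ⋅ _)) by apply mul_join_r.
  apply ne_foldmap_ext; intro s; rewrite ne_foldmap_map.
  symmetry; apply (ne_foldmap_morph (join L) (join L) (mul L (basic_eval s))), mul_join_l.
Qed.

Lemma row_inv_spec a : cnf_eval (row_inv a) = inv L (row_eval a).
Proof.
  unfold row_inv, cnf_eval; rewrite ne_foldmap_map.
  symmetry; apply (ne_foldmap_morph (join L) (meet L) (inv L)), inv_join.
Qed.

Hypothesis meet_join_distr : forall a b c : L, a ⊓ (b ⊔ c) = a ⊓ b ⊔ a ⊓ c.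

Lemma cnf_eval_join A B : cnf_eval (cnf_join A B) = cnf_eval A ⊔ cnf_eval B.
Proof.
  unfold cnf_join, cnf_eval; rewrite ne_foldmap_bind by apply meet_assoc_sym.
  rewrite (ne_foldmap_morph (meet L) (meet L) (fun x => x ⊔ _))
    by (intros; apply join_meet_distr_r, meet_join_distr).
  apply ne_foldmap_ext; intro a; rewrite ne_foldmap_map.
  rewrite (ne_foldmap_morph (meet L) (meet L) (join L (row_eval a)))
    by (intros; apply join_meet_distr_l, meet_join_distr).
  apply ne_foldmap_ext; intro b; apply row_eval_app.
Qed.

Lemma cnf_eval_inv A : cnf_eval (cnf_inv A) = inv L (cnf_eval A).
Proof.
  unfold cnf_inv; rewrite (ne_foldmap_morph cnf_join (join L) cnf_eval)
    by apply cnf_eval_join.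
  unfold cnf_eval at 2; rewrite (ne_foldmap_morph (meet L) (join L) (inv L))
    by apply inv_meet.
  apply ne_foldmap_ext, row_inv_spec.
Qed.

Hypothesis mul_meet_distr :
  forall a b1 b2 c : L, a ⋅ (b1 ⊓ b2) ⋅ c = a ⋅ b1 ⋅ c ⊓ a ⋅ b2 ⋅ c.

Lemma cnf_eval_mul A B : cnf_eval (cnf_mul A B) = cnf_eval A ⋅ cnf_eval B.
Proof.
  unfold cnf_mul, cnf_eval; rewrite ne_foldmap_bind by apply meet_assoc_sym.
  rewrite (ne_foldmap_morph (meet L) (meet L) (fun x => x ⋅ _))
    by (intros; apply mul_meet_r, mul_meet_distr).
  apply ne_foldmap_ext; intro a; rewrite ne_foldmap_map.
  rewrite (ne_foldmap_morph (meet L) (meet L) (mul L (row_eval a)))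
    by (intros; apply mul_meet_l, mul_meet_distr).
  apply ne_foldmap_ext; intro b; apply row_eval_mul.
Qed.

Lemma cnf_of_spec t : eval L v t = cnf_eval (cnf_of t).
Proof.
  induction t as [n | s IHs t IHt | s IHs t IHt | s IHs t IHt | t IHt |]; cbn [eval cnf_of].
  - reflexivity.
  - now rewrite cnf_eval_app, IHs, IHt.
  - now rewrite cnf_eval_join, IHs, IHt.
  - now rewrite cnf_eval_mul, IHs, IHt.
  - now rewrite cnf_eval_inv, IHt.
  - reflexivity.
Qed.

Lemma eval_fold_left_join (ts : list term) t :
  eval L v (fold_left TJoin ts t) = fold_left (join L) (map (eval L v) ts) (eval L v t).
Proof. now apply fold_left_morph. Qed.

Lemma eval_fold_left_meet (ts : list term) t :
  eval L v (fold_left TMeet ts t) = fold_left (meet L) (map (eval L v) ts) (eval L v t).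
Proof. now apply fold_left_morph. Qed.

Lemma eval_big_join_row_terms a : eval L v (big_join (row_terms a)) = row_eval a.
Proof.
  destruct a as [s ss]; cbn [row_terms ne_list map big_join].
  now rewrite eval_fold_left_join, map_map.
Qed.

Lemma eval_meet_of_joins_cnf_table A : eval L v (meet_of_joins (cnf_table A)) = cnf_eval A.
Proof.
  destruct A as [a As]; cbn [meet_of_joins cnf_table ne_list map big_meet].
  rewrite eval_fold_left_meet, eval_big_join_row_terms, !map_map.
  unfold cnf_eval, ne_foldmap; cbn [fst snd].
  f_equal; apply map_ext, eval_big_join_row_terms.
Qed.

End CnfSemantics.

Theorem lemma2p1 :
  { f : term -> list (list term) |
    forall t : term,
      f t <> nil /\
      (forall row, In row (f t) -> row <> nil /\ forall s, In s row -> is_basic s) /\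
      (forall L : IRL, fully_distributive L -> models_eq L t (meet_of_joins (f t))) }.
Proof.
  exists (fun t => cnf_table (cnf_of t)); intro t; split; [|split].
  - discriminate.
  - intros r r_in; apply in_map_iff in r_in as [a [<- _]]; split; [discriminate|].
    intros s s_in; apply in_map_iff in s_in as [b [<- _]].
    exact (proj2_sig b).
  - intros L [meet_join_distr mul_meet_distr] v.
    rewrite eval_meet_of_joins_cnf_table.
    now apply cnf_of_spec.
Qed.
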